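(* Let $\mathcal{X}$ be a Cayley scheme over a finite abelian group $G$, and let $U,L\in\mathfrak{S}(\mathcal{X})$ with $L\le U$ be such that $\mathcal{X}$ is the $U/L$-wreath product and $$\mathrm{Aut}(\mathcal{X}_{G/L})^{U/L}=\mathrm{Aut}(\mathcal{X}_U)^{U/L}.$$ Then $\mathrm{Aut}(\mathcal{X})^U=\mathrm{Aut}(\mathcal{X}_U)$ and $\mathrm{Aut}(\mathcal{X})^{G/L}=\mathrm{Aut}(\mathcal{X}_{G/L})$.
   Context: A coherent configuration on a finite set $\Omega$ is a pair $(\Omega,S)$, $S$ a partition of $\Omega\times\Omega$ such that $1_\Omega$ is a union of elements of $S$, $S$ is closed under transposition $s\mapsto s^*$, and for $r,s,t\in S$ the number $|\alpha r\cap\beta s^*|$ (with $\alpha r=\{\beta':(\alpha,\beta')\in r\}$) is independent of $(\alpha,\beta)\in t$. Its automorphism group $\mathrm{Aut}$ consists of the permutations fixing every element of $S$. For a group $G$, $G_{right}$ is the group of right multiplications $x\mapsto xg$. A Cayley scheme over $G$ is a coherent configuration $\mathcal{X}=(G,S)$ with $G_{right}\le\mathrm{Aut}(\mathcal{X})$. For every equivalence relation $E$ on $G$ that is a union of basis relations, the class $H_E$ of $E$ containing the identity is a subgroup and the classes of $E$ are the cosets of $H_E$; $\mathfrak{S}(\mathcal{X})$ is the set of all such subgroups $H_E$, and for $H\in\mathfrak{S}(\mathcal{X})$ let $E_H$ be the corresponding equivalence relation. For $H\in\mathfrak{S}(\mathcal{X})$: the restriction $\mathcal{X}_H=(H,\{s\cap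 (H\times H)\ne\varnothing: s\in S\})$, and the quotient $\mathcal{X}_{G/H}$ is the coherent configuration on the set $G/H$ of cosets whose basis relations are $s_{G/H}=\{(\Lambda,\Delta): s\cap(\Lambda\times\Delta)\ne\varnothing\}$, $s\in S$. For $L\le U$ in $\mathfrak{S}(\mathcal{X})$, $U/L$ is the set of $L$-cosets contained in $U$. $\mathcal{X}$ is the $U/L$-wreath product if every basis relation $r$ with $r\cap E_U=\varnothing$ is a union of sets $\Delta\times\Lambda$ with $\Delta,\Lambda$ cosets of $L$. For a permutation group $K$ and a set $\Delta$ (or set of blocks), $K^\Delta$ denotes the permutation group induced on $\Delta$ by the setwise stabilizer of $\Delta$ in $K$; e.g. $\mathrm{Aut}(\mathcal{X})^{G/L}$ is the group induced on the cosets of $L$, $\mathrm{Aut}(\mathcal{X}_{G/L})^{U/L}$ the group induced on $U/L$ by its setwise stabilizer in $\mathrm{Aut}(\mathcal{X}_{G/L})$, and $\mathrm{Aut}(\mathcal{X}_U)^{U/L}$ the group induced by $\mathrm{Aut}(\mathcal{X}_U)$ on the $L$-cosets in $U$. *)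

(* Defs.v *)
From mathcomp Require Import all_boot all_fingroup.

Set Implicit Arguments.
Unset Strict Implicit.
Unset Printing Implicit Defensive.

Import GroupScope.

(* A configuration is given by a carrier Omega, a subset of an ambient finite
   type, and a set S of relations on Omega. Restrictions then live on subsets
   of the same type, quotients on sets of cosets. *)

Section Configurations.

Variable T : finType.
Implicit Types (Omega : {set T}) (S : {set {set T * T}}) (r s t E : {set T * T}).

Definition transpose s : {set T * T} := [set (x.2, x.1) | x in s].

Definition nbrs (a : T) r : {set T} := [set b | (a, b) \in r].

Definition is_union (I : finType) (F : {set {set I}}) (A : {set I}) : Prop :=
  exists2 P : {set {set I}}, P \subset F & A = cover P.

(* [partition] excludes the empty set from its blocks. *)
Definition coherent Omega S : Prop :=
  [/\ partition S (setX Omega Omega),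
      is_union S [set (x, x) | x in Omega],
      {in S, forall s, transpose s \in S} &
      {in S & S & S, forall r s t (a b a' b' : T),
         (a, b) \in t -> (a', b') \in t ->
         #|nbrs a r :&: nbrs b (transpose s)|
           = #|nbrs a' r :&: nbrs b' (transpose s)|}].

(* Permutations of a subset Omega are the permutations of T supported in it. *)
Definition Aut_conf Omega S : {set {perm T}} :=
  [set p in Sym Omega | [forall s in S, [set (p x.1, p x.2) | x in s] == s]].

Definition restriction S (H : {set T}) : {set {set T * T}} :=
  [set s :&: setX H H | s in S] :\ set0.

Definition equivalence_on Omega E : Prop :=
  E \subset setX Omega Omega
  /\ {in Omega & &, equivalence_rel [rel x y | (x, y) \in E]}.

End Configurations.

(* The group K^D induced on D by its setwise stabilizer in K, for K acting on T
   through [to]. The action is 'P when D is a set of points and 'P^* when D is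
   a set of blocks. The elements of K^D are again permutations of the ambient
   type, supported in D. *)
Definition induced (aT : finGroupType) (T : finType)
    (to : {action aT &-> T}) (K : {set aT}) (D : {set T}) : {set {perm T}} :=
  [set restr_perm D (actperm to a) | a in 'N_K(D | to)].

Section CayleySchemes.

Variable gT : finGroupType.
Implicit Types (G H L U : {group gT}) (S : {set {set gT * gT}}).

Definition G_right G : {set {perm gT}} :=
  [set restr_perm G (actperm 'R g) | g in G].

Definition cayley_scheme G S : Prop :=
  coherent G S /\ G_right G \subset Aut_conf G S.

Definition scheme_subgroup G S H : Prop :=
  exists E : {set gT * gT},
    [/\ equivalence_on G E, is_union S E & H = [set x | (1, x) \in E] :> {set gT}].

(* Invariance of E under G_right makes its classes the right cosets of H_E. *)
Definition coset_equiv G H : {set gT * gT} :=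
  [set x in setX G G | H :* x.1 == H :* x.2].

Definition quotient_rel G H (s : {set gT * gT}) : {set {set gT} * {set gT}} :=
  [set B in setX (rcosets H G) (rcosets H G) | s :&: setX B.1 B.2 != set0].

Definition quotient_conf G S H : {set {set {set gT} * {set gT}}} :=
  [set quotient_rel G H s | s in S].

Definition wreath_product G S U L : Prop :=
  {in S, forall r, r :&: coset_equiv G U = set0 ->
     is_union [set setX A B | A in rcosets L G, B in rcosets L G] r}.

End CayleySchemes.

(* Main.v *)
Require Import Defs.
From mathcomp Require Import all_boot all_fingroup.

Set Implicit Arguments.
Unset Strict Implicit.
Unset Printing Implicit Defensive.

Import GroupScope.

(* An automorphism h of the quotient X_{G/L} lifts to X by gluing: on each coset
   U x, translations reduce h to an automorphism of X_{G/L} stabilizing U/L,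
   which by hypothesis is induced by some automorphism of X_U. The glued map
   preserves the relations inside E_U because each piece does, and the other
   relations because they are determined by their images in G/L. For the
   restriction to U, an automorphism f of X_U agrees on U/L with such a lift; the
   discrepancy fixes every L-coset in U, so extending it by the identity gives
   an automorphism of X. *)

(** * Permutations supported in a subset and automorphisms of configurations *)

Section Permutations.

Variable T : finType.
Implicit Types (D : {set T}) (S : {set {set T * T}}) (p q : {perm T}).

Lemma eq_in_Sym D p q : p \in Sym D -> q \in Sym D -> {in D, p =1 q} -> p = q.
Proof.
rewrite !inE => pD qD eqpq; apply/permP => x.
have [/eqpq //|xD] := boolP (x \in D).
by rewrite (out_perm pD xD) (out_perm qD xD).
Qed.

Lemma restr_perm_Sym D p : restr_perm D p \in Sym D.
Proof. by rewrite inE restr_perm_on. Qed.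

Lemma restr_actpermE (aT : finGroupType) (to : {action aT &-> T}) D a x :
  a \in 'N(D | to) -> x \in D -> restr_perm D (actperm to a) x = to x a.
Proof.
move=> nDa xD; rewrite restr_permE ?actpermE //.
rewrite !inE; apply/subsetP=> y yD.
by rewrite !inE /= /aperm actpermE astabs_act.
Qed.

(** One inclusion suffices: the image of [s] under the injective map induced by [p] has the
    cardinality of [s], so lying inside [s] forces equality. *)
Lemma Aut_confI D S p :
  p \in Sym D ->
  (forall s a b, s \in S -> (a, b) \in s -> (p a, p b) \in s) ->
  p \in Aut_conf D S.
Proof.
move=> pD pS; rewrite inE pD; apply/forall_inP => s sS.
rewrite eqEcard card_imset ?leqnn ?andbT.
  by apply/subsetP => _ /imsetP[[a b] abs ->]; exact: pS.
by move=> [a b] [c d] [/perm_inj-> /perm_inj->].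
Qed.

Lemma Aut_conf_Sym D S p : p \in Aut_conf D S -> p \in Sym D.
Proof. by rewrite inE => /andP[]. Qed.

Lemma Aut_conf_closed D S p x : p \in Aut_conf D S -> (p x \in D) = (x \in D).
Proof. by move/Aut_conf_Sym; rewrite inE => /perm_closed->. Qed.

Lemma Aut_confE D S p s a b :
  p \in Aut_conf D S -> s \in S -> ((p a, p b) \in s) = ((a, b) \in s).
Proof.
rewrite inE => /andP[_ /forall_inP pS] /pS/eqP ps.
rewrite -[in LHS]ps; apply/imsetP/idP => [[[c d] cds]|abs]; last by exists (a, b).
by case=> /perm_inj-> /perm_inj->.
Qed.

Lemma Aut_confM D S p q :
  p \in Aut_conf D S -> q \in Aut_conf D S -> p * q \in Aut_conf D S.
Proof.
move=> pA qA; apply: Aut_confI => [|s a b sS]; last first.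
  by rewrite !permM (Aut_confE _ _ qA sS) (Aut_confE _ _ pA sS).
have := (Aut_conf_Sym pA, Aut_conf_Sym qA).
by rewrite !inE => -[]; apply: perm_onM.
Qed.

Lemma Aut_confV D S p : p \in Aut_conf D S -> p^-1 \in Aut_conf D S.
Proof.
move=> pA; apply: Aut_confI => [|s a b sS].
  by have := Aut_conf_Sym pA; rewrite !inE; apply: perm_onV.
by move=> abs; rewrite -(Aut_confE _ _ pA sS) !permKV.
Qed.

Lemma Aut_restrictionI S D p :
  p \in Sym D ->
  (forall s a b, s \in S -> a \in D -> b \in D ->
     (a, b) \in s -> (p a, p b) \in s) ->
  p \in Aut_conf D (restriction S D).
Proof.
move=> pD pS; apply: Aut_confI => // _ a b /setD1P[_ /imsetP[s sS ->]].
have pDE x : (p x \in D) = (x \in D) by move: pD; rewrite inE => /perm_closed->.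
by rewrite !inE /= !pDE => /and3P[abs aD bD]; rewrite aD bD pS.
Qed.

Lemma Aut_restrictionE S D p s a b :
  p \in Aut_conf D (restriction S D) -> s \in S -> a \in D -> b \in D ->
  ((p a, p b) \in s) = ((a, b) \in s).
Proof.
move=> pA sS aD bD; set t := s :&: setX D D.
have tE c d : c \in D -> d \in D -> ((c, d) \in s) = ((c, d) \in t).
  by move=> cD dD; rewrite in_setI in_setX cD dD !andbT.
rewrite !tE ?(Aut_conf_closed _ pA) //.
(* [restriction] discards empty traces, so an empty [t] is handled apart; both memberships are then
   false. *)
have [->|t0] := eqVneq t set0; first by rewrite !inE.
by apply: (Aut_confE _ _ pA); rewrite !inE t0; apply/imsetP; exists s.
Qed.

End Permutations.

(** * Cosets, quotients and the wreath condition in a Cayley scheme *)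

Section CayleySchemes.

Variables (gT : finGroupType) (G : {group gT}) (S : {set {set gT * gT}}).
Hypothesis schS : cayley_scheme G S.
Implicit Types (H K L U : {group gT}) (p : {perm gT}).

Lemma rel_carrier s a b : s \in S -> (a, b) \in s -> a \in G /\ b \in G.
Proof.
case: schS => -[/and3P[/eqP covS _ _] _ _ _] _ sS abs.
have : (a, b) \in setX G G by rewrite -covS; apply/bigcupP; exists s.
by rewrite inE => /andP[].
Qed.

Lemma rel_exists a b : a \in G -> b \in G -> exists2 s, s \in S & (a, b) \in s.
Proof.
case: schS => -[/and3P[/eqP covS _ _] _ _ _] _ aG bG.
have : (a, b) \in cover S by rewrite covS inE aG.
by case/bigcupP => s; exists s.
Qed.

Lemma rel_inj s t x : s \in S -> t \in S -> x \in s -> x \in t -> s = t.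
Proof.
case: schS => -[/and3P[_ trS _] _ _ _] _ sS tS xs xt.
by rewrite -(def_pblock trS sS xs) -(def_pblock trS tS xt).
Qed.

Lemma right_mul_Aut g :
  g \in G -> exists2 p, p \in Aut_conf G S & {in G, forall x, p x = x * g}.
Proof.
case: schS => _ /subsetP rS gG; exists (restr_perm G (actperm 'R g)).
  by apply: rS; apply: imset_f.
move=> x xG; apply: restr_actpermE => //.
by rewrite !inE; apply/subsetP => y yG; rewrite !inE groupM.
Qed.

Lemma rel_mulr s a b g : s \in S -> a \in G -> b \in G -> g \in G ->
  ((a * g, b * g) \in s) = ((a, b) \in s).
Proof.
move=> sS aG bG /right_mul_Aut[p pA pE].
by rewrite -!pE // (Aut_confE _ _ pA).
Qed.

Lemma rel_coset H s a b c d : scheme_subgroup G S H -> s \in S ->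
  (a, b) \in s -> (c, d) \in s -> H :* a = H :* b -> H :* c = H :* d.
Proof.
case=> _ [[_ _] [P /subsetP PS ->] defH] sS abs cds.
have [[aG bG] [cG dG]] := (rel_carrier sS abs, rel_carrier sS cds).
(* Right translation by the inverse of [x] moves (x, y) to (1, y x^-1), which identifies the classes
   of the relation with right cosets of [H]. *)
have inH x y : x \in G -> y \in G ->
    reflect (H :* x = H :* y) ((x, y) \in cover P).
  move=> xG yG; apply: (iffP idP).
    case/bigcupP => t tP xyt; apply/esym/rcoset_eqP.
    rewrite mem_rcoset defH inE; apply/bigcupP; exists t => //.
    by rewrite -(mulgV x) rel_mulr ?groupV ?PS.
  move/esym/rcoset_eqP; rewrite mem_rcoset defH inE => /bigcupP[t tP].
  rewrite -(mulgV x) rel_mulr ?groupV ?PS // => xyt.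
  by apply/bigcupP; exists t.
move/(inH _ _ aG bG)/bigcupP => [t tP abt]; apply/inH => //.
by apply/bigcupP; exists t => //; rewrite -(rel_inj sS (PS _ tP) abs abt).
Qed.

Lemma coset_transport H a b c d : scheme_subgroup G S H ->
    a \in G -> b \in G ->
    (forall s, s \in S -> (a, b) \in s -> (c, d) \in s) ->
  (H :* a = H :* b) <-> (H :* c = H :* d).
Proof.
move=> schH aG bG abcd; have [s sS abs] := rel_exists aG bG.
have cds := abcd _ sS abs.
by split; [apply: (rel_coset schH sS abs)|apply: (rel_coset schH sS cds)].
Qed.

Lemma scheme_subgroup_sub H : scheme_subgroup G S H -> H \subset G.
Proof.
case=> E [[/subsetP EG _] _ ->]; apply/subsetP => x.
by rewrite inE => /EG; rewrite inE => /andP[].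
Qed.

Lemma rcosets_f L a : a \in G -> L :* a \in rcosets L G.
Proof. by move=> aG; apply/rcosetsP; exists a. Qed.

Lemma quotient_relP L (s : {set gT * gT}) a b : a \in G -> b \in G ->
  reflect (exists a' b', [/\ L :* a' = L :* a, L :* b' = L :* b & (a', b') \in s])
          ((L :* a, L :* b) \in quotient_rel G L s).
Proof.
move=> aG bG; rewrite !inE /= !rcosets_f //=; apply: (iffP (set0Pn _)).
  case=> -[a' b']; rewrite !inE /= => /and3P[abs /rcoset_eqP aE /rcoset_eqP bE].
  by exists a', b'.
case=> a' [b' [aE bE abs]]; exists (a', b').
by rewrite !inE /= abs -aE -bE !rcoset_refl.
Qed.

(** The image lies in the coset of [p x] and has the same cardinality, [p] being injective. *)
Lemma imset_rcoset H K p x : H \subset K ->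
    {in K &, forall a b, H :* a = H :* b -> H :* p a = H :* p b} ->
  x \in K -> p @: (H :* x) = H :* p x.
Proof.
move=> sHK pH xK; apply/eqP; rewrite eqEcard card_imset; last exact: perm_inj.
rewrite !card_rcoset leqnn andbT; apply/subsetP => _ /imsetP[y yHx ->].
have yK : y \in K by case/rcosetP: yHx => h /(subsetP sHK) hK ->; rewrite groupM.
by apply/rcoset_eqP/pH => //; apply/rcoset_eqP.
Qed.

Lemma stab_rcosets H K p : H \subset K -> p \in Sym K ->
    {in K &, forall a b, H :* a = H :* b -> H :* p a = H :* p b} ->
  p \in 'N(rcosets H K | 'P^*).
Proof.
move=> sHK; rewrite !inE /= => pK pH; apply/subsetP => _ /rcosetsP[x xK ->].
rewrite !inE /= setactE (imset_rcoset sHK pH xK).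
by apply/rcosetsP; exists (p x); rewrite ?(perm_closed _ pK).
Qed.

Lemma Aut_rcoset L p : scheme_subgroup G S L -> p \in Aut_conf G S ->
  {in G &, forall a b, L :* a = L :* b <-> L :* p a = L :* p b}.
Proof.
move=> schL pA a b aG bG; apply: (coset_transport schL) => // s sS.
by rewrite (Aut_confE _ _ pA).
Qed.

Lemma Aut_restriction_rcoset L U p : scheme_subgroup G S L -> U \subset G ->
    p \in Aut_conf U (restriction S U) ->
  {in U &, forall a b, L :* a = L :* b <-> L :* p a = L :* p b}.
Proof.
move=> schL sUG pA a b aU bU.
apply: (coset_transport schL) => [||s sS]; rewrite ?(subsetP sUG) //.
by rewrite (Aut_restrictionE pA).
Qed.

Lemma Aut_quotient L p (D := rcosets L G) (h := restr_perm D (actperm 'P^* p)) :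
    scheme_subgroup G S L -> p \in Aut_conf G S ->
  [/\ p \in 'N(D | 'P^*), h \in Aut_conf D (quotient_conf G S L)
    & {in G, forall x, h (L :* x) = L :* p x}].
Proof.
move=> schL pA; have sLG := scheme_subgroup_sub schL.
have pL : {in G &, forall a b, L :* a = L :* b -> L :* p a = L :* p b}.
  by move=> a b aG bG; case: (Aut_rcoset schL pA aG bG).
have pN : p \in 'N(D | 'P^*) by apply: stab_rcosets => //; apply: Aut_conf_Sym pA.
have hE : {in G, forall x, h (L :* x) = L :* p x}.
  move=> x xG; rewrite /h restr_actpermE ?rcosets_f //= setactE.
  exact: imset_rcoset pL xG.
split=> //; apply: Aut_confI => [|_ A B /imsetP[s sS ->]].
  exact: restr_perm_Sym.
move=> ABs.
have /andP[/rcosetsP[a aG aE] /rcosetsP[b bG bE]] : (A \in D) && (B \in D).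
  by move: ABs; rewrite !inE => /andP[].
move: ABs; rewrite {}aE {}bE => /(quotient_relP _ _ aG bG)[a' [b' [aE bE abs]]].
have [a'G b'G] := rel_carrier sS abs.
rewrite -aE -bE !hE //; apply/quotient_relP; rewrite ?(Aut_conf_closed _ pA) //.
by exists (p a'), (p b'); rewrite (Aut_confE _ _ pA).
Qed.

(** Since L <= U, an L-coset determines its U-coset. A basis relation through (a, b) has its
    quotient preserved by [h], hence contains a pair with entries in L a' and L b', and [rel_coset]
    compares the two pairs. *)
Lemma Aut_quotient_rcoset L U h a b a' b' : scheme_subgroup G S L ->
    scheme_subgroup G S U -> L \subset U ->
    h \in Aut_conf (rcosets L G) (quotient_conf G S L) ->
    a \in G -> b \in G -> a' \in G -> b' \in G ->
    h (L :* a) = L :* a' -> h (L :* b) = L :* b' ->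
  U :* a = U :* b -> U :* a' = U :* b'.
Proof.
move=> schL schU sLU hA aG bG a'G b'G haE hbE Uab.
have LU x y : L :* x = L :* y -> U :* x = U :* y.
  move/esym/rcoset_eqP => yLx; apply/esym/rcoset_eqP.
  by rewrite mem_rcoset (subsetP sLU) -?mem_rcoset.
have [s sS abs] := rel_exists aG bG.
have : (h (L :* a), h (L :* b)) \in quotient_rel G L s.
  rewrite (Aut_confE _ _ hA) ?imset_f //.
  by apply/quotient_relP => //; exists a, b.
rewrite haE hbE => /(quotient_relP _ _ a'G b'G)[c [d [/LU<- /LU<- cds]]].
exact: rel_coset schU sS abs cds Uab.
Qed.

(** A single pair of [s] outside E_U forces all of [s] outside E_U, so [s] is a union of products of
    L-cosets and the entries of a pair may vary in theirs. *)
Lemma wreath_rel U L s a b a' b' : scheme_subgroup G S U ->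
    wreath_product G S U L -> s \in S -> (a, b) \in s ->
    U :* a <> U :* b -> L :* a = L :* a' -> L :* b = L :* b' ->
  (a', b') \in s.
Proof.
move=> schU wrS sS abs nUab aE bE.
case: (wrS s sS) => [|P /subsetP PX defs].
  apply/setP => -[c d]; rewrite !inE /=; apply/negbTE/and3P.
  by case=> cds _ /eqP/(rel_coset schU sS cds abs).
move: abs; rewrite {}defs => /bigcupP[t tP abt]; apply/bigcupP; exists t => //.
have /imset2P[_ _ /rcosetsP[x _ ->] /rcosetsP[y _ ->] tE] := PX t tP.
move: abt; rewrite tE !inE /= => /andP[/rcoset_eqP<- /rcoset_eqP<-].
by rewrite aE bE !rcoset_refl.
Qed.

End CayleySchemes.

(** * Extending automorphisms from [U] and lifting them from G/L *)

Section Lifting.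

Variables (gT : finGroupType) (G U L : {group gT}) (S : {set {set gT * gT}}).
Hypotheses (schS : cayley_scheme G S) (schU : scheme_subgroup G S U).
Hypotheses (schL : scheme_subgroup G S L) (sLU : L \subset U).
Hypothesis wrS : wreath_product G S U L.

Let sUG : U \subset G. Proof. exact: scheme_subgroup_sub schU. Qed.

(** Being supported in [U], [k] fixes every L-coset of [G], so pairs across U-cosets are covered by
    the wreath condition. A pair inside one U-coset lies either in [U], where [k] is an
    automorphism, or off [U], where [k] is the identity. *)
Lemma extend_trivial_Aut k : k \in Aut_conf U (restriction S U) ->
  {in U, forall u, L :* k u = L :* u} -> k \in Aut_conf G S.
Proof.
move=> kA kL; have kU : perm_on U k by have := Aut_conf_Sym kA; rewrite inE.
have kL1 x : L :* k x = L :* x.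
  by have [/kL //|xU] := boolP (x \in U); rewrite (out_perm kU xU).
apply: Aut_confI => [|s a b sS abs].
  by rewrite inE; apply: subset_trans kU sUG.
have [aG bG] := rel_carrier schS sS abs.
have [Uab|/eqP nUab] := eqVneq (U :* a) (U :* b); last first.
  exact: (wreath_rel schS schU wrS sS abs nUab).
have [aU|aU] := boolP (a \in U); have [bU|bU] := boolP (b \in U).
- by rewrite (Aut_restrictionE kA).
- by case/negP: bU; rewrite -(rcoset_id aU) Uab rcoset_refl.
- by case/negP: aU; rewrite -(rcoset_id bU) -Uab rcoset_refl.
by rewrite !(out_perm kU).
Qed.

Hypothesis sUL :
  induced 'P (Aut_conf (rcosets L G) (quotient_conf G S L)) (rcosets L U)
  \subset induced 'P^* (Aut_conf U (restriction S U)) (rcosets L U).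

(* Translating the block U x and its image to U turns h into an automorphism of
   the quotient stabilizing U/L, so the hypothesis applies to it. *)
Lemma lift_on_coset h x :
    h \in Aut_conf (rcosets L G) (quotient_conf G S L) -> x \in G ->
  exists ky : {perm gT} * gT,
    [/\ ky.1 \in Aut_conf U (restriction S U), ky.2 \in G
      & {in U, forall u, L :* (ky.1 u * ky.2) = h (L :* (u * x))}].
Proof.
move=> hA xG; have [p /(Aut_quotient schS schL)[_ qA qE] pE] :=
  right_mul_Aut schS xG.
have /rcosetsP[y yG hxE] : h (L :* x) \in rcosets L G.
  by rewrite (Aut_conf_closed _ hA) rcosets_f.
have yVG : y^-1 \in G by rewrite groupV.
have [p' /(Aut_quotient schS schL)[_ q'A q'E] p'E] := right_mul_Aut schS yVG.
set q := restr_perm _ _ in qA qE; set q' := restr_perm _ _ in q'A q'E.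
(* Products act from left to right: [q] carries U/L to the L-cosets in U x, [h] moves these, and
   [q'] translates by [y^-1]. As [y] represents the image of L x, [t] fixes the coset L. *)
pose t := q * h * q'.
have tA : t \in Aut_conf (rcosets L G) (quotient_conf G S L) by rewrite !Aut_confM.
have tE u : u \in G -> t (L :* u) = h (L :* (u * x)) :* y^-1.
  move=> uG; rewrite !permM qE // pE //.
  have /rcosetsP[z zG ->] : h (L :* (u * x)) \in rcosets L G.
    by rewrite (Aut_conf_closed _ hA) rcosets_f // groupM.
  by rewrite q'E // p'E // rcosetM.
have t1 : t (L :* 1) = L :* 1.
  by rewrite tE // mul1g hxE -rcosetM mulgV.
(* [t] fixes L and respects U-cosets, so it maps L-cosets in [U] to L-cosets in [U]. *)
have tU : t \in 'N(rcosets L U | 'P).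
  rewrite !inE; apply/subsetP => _ /rcosetsP[u uU ->]; rewrite !inE /= /aperm.
  have uG := subsetP sUG _ uU.
  have /rcosetsP[v vG tuE] : t (L :* u) \in rcosets L G.
    by rewrite (Aut_conf_closed _ tA) rcosets_f.
  rewrite tuE; apply/rcosetsP; exists v => //.
  have : U :* 1 = U :* v.
    apply: (Aut_quotient_rcoset schS schL schU sLU tA _ uG _ vG t1 tuE) => //.
    by rewrite mulg1 rcoset_id.
  by rewrite mulg1 => ->; apply: rcoset_refl.
have /(subsetP sUL)/imsetP[k /setIP[kA kN] tkE] :
    restr_perm (rcosets L U) (actperm 'P t) \in
    induced 'P (Aut_conf (rcosets L G) (quotient_conf G S L)) (rcosets L U).
  by apply: imset_f; rewrite inE tA.
exists (k, y); split=> //= u uU.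
have LuU : L :* u \in rcosets L U by apply/rcosetsP; exists u.
have := congr1 (fun f : {perm _} => f (L :* u)) tkE.
rewrite /= !restr_actpermE // /= /aperm tE ?(subsetP sUG) // setactE => tuE.
have /rcosetsP[z zG hE] : h (L :* (u * x)) \in rcosets L G.
  by rewrite (Aut_conf_closed _ hA) rcosets_f // groupM // (subsetP sUG).
rewrite hE -rcosetM in tuE *; apply/rcoset_eqP.
rewrite mem_rcoset -mulgA -[_ * z^-1]invgK invMg invgK -mem_rcoset tuE.
by apply: imset_f; apply: rcoset_refl.
Qed.

Lemma lift_Aut_quotient h :
    h \in Aut_conf (rcosets L G) (quotient_conf G S L) ->
  exists2 p, p \in Aut_conf G S & {in G, forall z, L :* p z = h (L :* z)}.
Proof.
move=> hA.
(* One pair (automorphism of X_U, translation) is chosen for every [x]; outside [G] the value is a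
   dummy. *)
have /fin_all_exists[ky kyP] x : exists ky : {perm gT} * gT, x \in G ->
    [/\ ky.1 \in Aut_conf U (restriction S U), ky.2 \in G
      & {in U, forall u, L :* (ky.1 u * ky.2) = h (L :* (u * x))}].
  have [xG|xG] := boolP (x \in G); last by exists (1, 1).
  by have [ky kyP] := lift_on_coset hA xG; exists ky.
(* A fixed representative of each U-coset, so that the same pair [ky (r z)] serves the whole
   coset. *)
pose r z := repr (U :* z).
have rU z : z * (r z)^-1 \in U.
  by rewrite -mem_rcoset; apply/rcoset_eqP/esym/rcoset_eqP/mem_repr_rcoset.
have rG z : z \in G -> r z \in G.
  by move=> zG; have := subsetP sUG _ (rU z); rewrite groupMl // groupV.
(* Writing z = u r(z) with u in [U], the glued map applies the chosen automorphism to u and then the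
   chosen translation. *)
pose f z := if z \in G then (ky (r z)).1 (z * (r z)^-1) * (ky (r z)).2 else z.
have fG z : (f z \in G) = (z \in G).
  rewrite /f; have [zG|/negbTE-> //] := boolP (z \in G).
  have [kA yG _] := kyP _ (rG z zG).
  by rewrite groupM // (subsetP sUG) // (Aut_conf_closed _ kA).
have fL z : z \in G -> L :* f z = h (L :* z).
  move=> zG; rewrite /f zG; have [_ _ ->] := kyP _ (rG z zG) => //.
  by rewrite mulgKV.
(* Equal values give equal L-cosets because [h] is injective, hence the same representative; on that
   U-coset [f] is a composite of injective maps. *)
have fI : injective f.
  move=> z z' fzz'; have [zG|zG] := boolP (z \in G); last first.
    have z'G : z' \notin G by rewrite -fG -fzz' fG.
    by move: fzz'; rewrite /f (negbTE zG) (negbTE z'G).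
  have z'G : z' \in G by rewrite -fG -fzz' fG.
  have LzE : L :* z = L :* z' by apply: (@perm_inj _ h); rewrite -!fL // fzz'.
  have rE : r z = r z'.
    congr repr; apply/rcoset_eqP; rewrite mem_rcoset (subsetP sLU) // -mem_rcoset.
    exact/rcoset_eqP.
  by move: fzz'; rewrite /f zG z'G rE => /mulIg/perm_inj/mulIg.
exists (perm fI) => [|z zG]; last by rewrite permE fL.
apply: Aut_confI => [|s a b sS abs].
  rewrite inE; apply/subsetP => z.
  by rewrite inE permE /f; case: ifP; rewrite ?eqxx.
have [aG bG] := rel_carrier schS sS abs; rewrite !permE.
(* Inside one U-coset, [f] is a translation into [U], an automorphism of X_U and another
   translation, each preserving [s]. *)
have [Uab|/eqP nUab] := eqVneq (U :* a) (U :* b).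
  have rE : r b = r a by rewrite /r Uab.
  have [kA yG _] := kyP _ (rG a aG); rewrite /f aG bG rE.
  have aU := rU a; have bU := rU b; rewrite rE in bU.
  rewrite (rel_mulr schS) // ?(subsetP sUG) ?(Aut_conf_closed _ kA) //.
  by rewrite (Aut_restrictionE kA) // (rel_mulr schS) ?groupV ?rG.
(* Across U-cosets, [h] yields a pair (c, d) of [s] in the L-cosets of [f a] and [f b]. The wreath
   condition moves it to (f a, f b) once c and d are in different U-cosets; otherwise the inverse of
   [h] would put [a] and [b] in one U-coset. *)
have : (h (L :* a), h (L :* b)) \in quotient_rel G L s.
  rewrite (Aut_confE _ _ hA) ?imset_f //.
  by apply/quotient_relP => //; exists a, b.
rewrite -!fL // => /quotient_relP[||c [d [cE dE cds]]]; rewrite ?fG //.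
have [cG dG] := rel_carrier schS sS cds.
apply: (wreath_rel schS schU wrS sS cds _ cE dE) => Ucd; apply: nUab.
have hVE z z' : z' \in G -> L :* z = L :* f z' -> h^-1 (L :* z) = L :* z'.
  by move=> z'G ->; rewrite fL // permK.
exact: (Aut_quotient_rcoset schS schL schU sLU (Aut_confV hA) cG dG aG bG
  (hVE _ _ aG cE) (hVE _ _ bG dE) Ucd).
Qed.

End Lifting.

(** * The groups induced on [U] and on G/L *)

Theorem theorem4p1 (gT : finGroupType) (G : {group gT})
    (S : {set {set gT * gT}}) (U L : {group gT})
    (abG : abelian G) (schS : cayley_scheme G S)
    (schU : scheme_subgroup G S U) (schL : scheme_subgroup G S L)
    (sLU : L \subset U) (wrS : wreath_product G S U L)
    (eqUL :
      induced 'P (Aut_conf (rcosets L G) (quotient_conf G S L)) (rcosets L U)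
      = induced 'P^* (Aut_conf U (restriction S U)) (rcosets L U)) :
  induced 'P (Aut_conf G S) U = Aut_conf U (restriction S U)
  /\ induced 'P^* (Aut_conf G S) (rcosets L G)
     = Aut_conf (rcosets L G) (quotient_conf G S L).
Proof.
have sUG := scheme_subgroup_sub schU.
have lift h : h \in Aut_conf (rcosets L G) (quotient_conf G S L) ->
    exists2 p, p \in Aut_conf G S & {in G, forall z, L :* p z = h (L :* z)}.
  by apply: (lift_Aut_quotient schS schU schL sLU wrS); rewrite eqUL.
have restrA p : p \in Aut_conf G S -> p \in 'N(U | 'P) ->
    restr_perm U p \in Aut_conf U (restriction S U).
  move=> pA pU; apply: Aut_restrictionI => [|s a b sS aU bU abs].
    exact: restr_perm_Sym.
  by rewrite !restr_permE // (Aut_confE _ _ pA).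
have actP (T : finType) (p : {perm T}) : actperm 'P p = p.
  by apply/permP => x; rewrite actpermE.
split; apply/setP => f; apply/imsetP/idP.
- by case=> p /setIP[pA pU] ->; rewrite actP; apply: restrA.
- move=> fA; have fS := Aut_conf_Sym fA.
  have fL : {in U &, forall a b, L :* a = L :* b -> L :* f a = L :* f b}.
    by move=> a b aU bU; case: (Aut_restriction_rcoset schS schL sUG fA aU bU).
  have fN : f \in 'N(rcosets L U | 'P^*) by apply: stab_rcosets.
  have : restr_perm (rcosets L U) (actperm 'P^* f)
      \in induced 'P^* (Aut_conf U (restriction S U)) (rcosets L U).
    by apply: imset_f; rewrite inE fA.
  (* The action of [f] on U/L comes from an automorphism [h] of the quotient, whose lift [p] agrees
     with [f] on U/L. *)
  rewrite -eqUL => /imsetP[h /setIP[hA hN] fhE].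
  have [p pA pE] := lift h hA.
  have pL u : u \in U -> L :* p u = L :* f u.
    move=> uU; rewrite pE ?(subsetP sUG) //.
    have LuU : L :* u \in rcosets L U by apply/rcosetsP; exists u.
    have := congr1 (fun t : {perm _} => t (L :* u)) fhE.
    rewrite /= !restr_actpermE //= /aperm setactE => <-.
    exact: imset_rcoset fL uU.
  (* For u in [U], [p u] lies in L (f u), which is contained in [U]. *)
  have pU : p \in 'N(U | 'P).
    rewrite !inE; apply/subsetP => u uU; rewrite !inE /= /aperm.
    have : p u \in L :* f u by rewrite -pL // rcoset_refl.
    case/rcosetP => l lL ->; rewrite groupM ?(Aut_conf_closed _ fA) //.
    exact: subsetP sLU _ lL.
  (* The discrepancy on [U]: it undoes [p] and then applies [f], so it fixes each L-coset in [U] and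
     extends to [G] by the identity. Then [p * k] restricts to [f] on [U]. *)
  pose k := (restr_perm U p)^-1 * f.
  have kA : k \in Aut_conf U (restriction S U).
    by rewrite Aut_confM ?Aut_confV ?restrA.
  have kL u : u \in U -> L :* k u = L :* u.
    move=> uU; have vU : (restr_perm U p)^-1 u \in U.
      by rewrite (Aut_conf_closed _ (Aut_confV (restrA _ pA pU))).
    by rewrite permM -pL // -(restr_permE pU vU) permKV.
  have kAG : k \in Aut_conf G S.
    exact: (extend_trivial_Aut schS schU wrS kA kL).
  have pkU : p * k \in 'N(U | 'P).
    rewrite groupM // !inE; apply/subsetP => u uU.
    by rewrite !inE /= /aperm (Aut_conf_closed _ kA).
  exists (p * k); first by rewrite inE pkU Aut_confM.
  rewrite actP; apply: (eq_in_Sym fS (restr_perm_Sym _ _)) => u uU.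
  by rewrite restr_permE // !permM -(restr_permE pU) // permK.
- by case=> p /setIP[pA _] ->; have [] := Aut_quotient schS schL pA.
move=> hA; have [p pA pE] := lift f hA.
have [pN _ qE] := Aut_quotient schS schL pA.
exists p; first by rewrite inE pA.
apply: eq_in_Sym (Aut_conf_Sym hA) (restr_perm_Sym _ _) _ => _ /rcosetsP[x xG ->].
by rewrite qE // pE.
Qed.
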